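(* Let $(\Psi,\Psi',\mathbf{f}_n)$ be a latent dynamics model for the full-order state $\mathbf{u}_h$, with latent state $\mathbf{u}_n$ and approximation $\tilde{\mathbf{u}}_h(t;\boldsymbol{\mu})=\Psi'(\mathbf{u}_n(t;\boldsymbol{\mu}))$, under the hypotheses given in the context. Then, for any $\boldsymbol{\mu}\in\mathcal{P}$ and any $t\in[t_0,T]$, $$\|\mathbf{u}_h(t;\boldsymbol{\mu})-\tilde{\mathbf{u}}_h(t;\boldsymbol{\mu})\|\le\|\mathbf{u}_{0,h}-\Psi'\circ\Psi(\mathbf{u}_{0,h})\|_{L^\infty(\mathcal{P};\mathbb{R}^{N_h})}+|T-t_0|\,\|\mathbf{f}_h(\mathbf{u}_h)-\mathbf{J}_{\Psi',\mathbf{u}_n}\mathbf{f}_n(\mathbf{u}_n)\|_{L^\infty([t_0,T]\times\mathcal{P};\mathbb{R}^{N_h})},$$ where $\mathbf{J}_{\Psi',\mathbf{u}_n}$ is the Jacobian of $\Psi'$ with respect to $\mathbf{u}_n$.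
   Context: $\mathcal{P}\subset\mathbb{R}^{n_\mu}$ is compact, $\|\cdot\|$ is the Euclidean norm. $\mathbf{f}_h(\mathbf{u}_h)$ denotes $(t,\boldsymbol{\mu})\mapsto\mathbf{f}_h(t,\mathbf{u}_h(t;\boldsymbol{\mu});\boldsymbol{\mu})$, $\mathbf{f}_n(\mathbf{u}_n)$ denotes $(t,\boldsymbol{\mu})\mapsto\mathbf{f}_n(t,\mathbf{u}_n(t;\boldsymbol{\mu});\boldsymbol{\mu})$, and the Jacobian is evaluated along $\mathbf{u}_n(t;\boldsymbol{\mu})$. Full-order model: $\mathbf{u}_h\in C^1([t_0,T]\times\mathcal{P};\mathbb{R}^{N_h})$ satisfies, for each $\boldsymbol{\mu}\in\mathcal{P}$, $\dot{\mathbf{u}}_h(t;\boldsymbol{\mu})=\mathbf{f}_h(t,\mathbf{u}_h(t;\boldsymbol{\mu});\boldsymbol{\mu})$ for $t\in(t_0,T]$ and $\mathbf{u}_h(t_0;\boldsymbol{\mu})=\mathbf{u}_{0,h}(\boldsymbol{\mu})$. Latent dynamics model: with $n\ll N_h$, a triple $(\Psi,\Psi',\mathbf{f}_n)$ consisting of Lipschitz-continuous maps $\Psi:\mathbb{R}^{N_h}\to\mathbb{R}^n$, $\Psi':\mathbb{R}^n\to\mathbb{R}^{N_h}$ and a latent vector field $\mathbf{f}_n(t,\mathbf{u}_n;\boldsymbol{\mu})\in\mathbb{R}^n$, which solves $$\min_{\Psi',\mathbf{u}_n}\|\mathbf{u}_h-\Psi'(\mathbf{u}_n)\|^2_{L^2([t_0,T]\times\mathcal{P};\mathbb{R}^{N_h})}\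 \text{ s.t. }\ \dot{\mathbf{u}}_n(t;\boldsymbol{\mu})=\mathbf{f}_n(t,\mathbf{u}_n(t;\boldsymbol{\mu});\boldsymbol{\mu}),\ t\in(t_0,T],\quad\mathbf{u}_n(t_0;\boldsymbol{\mu})=\Psi(\mathbf{u}_{0,h}(\boldsymbol{\mu})),$$ where $\mathbf{u}_n\in C^1([t_0,T]\times\mathcal{P};\mathbb{R}^n)$ is the latent state. The vector fields $\mathbf{f}_h,\mathbf{f}_n$ are continuous, bounded, and locally Lipschitz in their second argument uniformly in $t$ and $\boldsymbol{\mu}$ (well-posedness conditions). The approximation is $\tilde{\mathbf{u}}_h(t;\boldsymbol{\mu})=\Psi'\big(\Psi(\mathbf{u}_{0,h}(\boldsymbol{\mu}))+\int_{t_0}^t\mathbf{f}_n(s,\mathbf{u}_n(s;\boldsymbol{\mu});\boldsymbol{\mu})\,ds\big)=\Psi'(\mathbf{u}_n(t;\boldsymbol{\mu}))$.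
   Formalization: Added assumptions: every nonempty relatively open part of P has positive Lebesgue measure (the bound fails e.g. for P a single point), and Ψ' is differentiable at u_n(t;μ) for almost every (t,μ), so that the Jacobian in the bound is defined. *)

(* Defs.v *)
From HB Require Import structures.
From mathcomp Require Import all_boot all_order all_algebra.
From mathcomp Require Import all_classical all_reals all_analysis.

Set Implicit Arguments.
Unset Strict Implicit.
Unset Printing Implicit Defensive.

Import Order.TTheory GRing.Theory Num.Theory.
Import numFieldNormedType.Exports.

Local Open Scope classical_set_scope.
Local Open Scope ring_scope.

Definition rV_display : measure_display.
Proof. exact: default_measure_display. Qed.

Section measurable_rV.
Context {R : realType} {n : nat}.

Let coor : 'I_n -> 'rV[R]_n -> measurableTypeR R := fun i x => x ord0 i.

Let rV_set0 : g_sigma_preimage coor set0.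
Proof. exact: sigma_algebra0. Qed.

Let rV_setC A : g_sigma_preimage coor A -> g_sigma_preimage coor (~` A).
Proof. exact: sigma_algebraC. Qed.

Let rV_bigcup (F : (set 'rV[R]_n)^nat) :
  (forall i, g_sigma_preimage coor (F i)) ->
  g_sigma_preimage coor (\bigcup_i (F i)).
Proof. exact: sigma_algebra_bigcup. Qed.

(* The sigma-algebra generated by the coordinates, i.e. the Borel one. *)
HB.instance Definition _ := @isMeasurable.Build rV_display
  'rV[R]_n (g_sigma_preimage coor) rV_set0 rV_setC rV_bigcup.

Lemma measurable_coord (i : 'I_n) :
  measurable_fun [set: 'rV[R]_n]
    (fun x : 'rV[R]_n => x ord0 i : measurableTypeR R).
Proof.
move=> _ Y mY; rewrite setTI; apply: sub_sigma_algebra => /=.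
rewrite -bigcup_seq/=; exists i => /=; first by rewrite mem_index_enum.
by exists Y => //; rewrite setTI.
Qed.

Lemma measurable_fun_rV d (T : measurableType d) (f : T -> 'rV[R]_n) :
  (forall i, measurable_fun [set: T]
     (fun x => f x ord0 i : measurableTypeR R)) ->
  measurable_fun [set: T] f.
Proof.
move=> mf _ A; rewrite /measurable/= => mA; rewrite setTI.
suff : g_sigma_preimage coor `<=` [set B | measurable (f @^-1` B)] by exact.
apply: smallest_sub.
  split => /=.
  - by rewrite preimage_set0; exact: measurable0.
  - by move=> B mB; rewrite setTD preimage_setC; exact: measurableC.
  - by move=> F mF; rewrite preimage_bigcup; exact: bigcup_measurable.
move=> B; rewrite -bigcup_seq => -[i _ [C mC <-]] /=.
by rewrite setTI -[X in measurable X]setTI; exact: (mf i measurableT C mC).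
Qed.

End measurable_rV.

Section lebesgue_rV.
Context {R : realType}.

Definition rV_cons n (p : measurableTypeR R * 'rV[R]_n) : 'rV[R]_n.+1 :=
  row_mx (p.1)%:M p.2 : 'rV[R]_(1 + n).

Definition rV_uncons n (x : 'rV[R]_n.+1) : measurableTypeR R * 'rV[R]_n :=
  (x ord0 ord0, rsubmx (x : 'rV[R]_(1 + n))).

Lemma rV_consK n : cancel (@rV_cons n) (@rV_uncons n).
Proof.
move=> [a v]; rewrite /rV_uncons /rV_cons /= row_mxKr; congr pair.
by rewrite !mxE; case: splitP => // j _; rewrite !ord1 mxE eqxx mulr1n.
Qed.

Lemma measurable_rV_cons n : measurable_fun setT (@rV_cons n).
Proof.
apply: measurable_fun_rV => i; rewrite /rV_cons.
case Ei : (fintype.split (i : 'I_(1 + n))) => [j|j].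
  apply: (eq_measurable_fun (fst : measurableTypeR R * 'rV[R]_n -> _)) => //.
  by move=> x _; rewrite mxE Ei !ord1 mxE eqxx mulr1n.
apply: (eq_measurable_fun
  ((fun v : 'rV[R]_n => v ord0 j : measurableTypeR R) \o snd)).
  by move=> x _ /=; rewrite mxE Ei.
by apply: measurableT_comp => //; exact: measurable_coord.
Qed.

Lemma measurable_rV_uncons n : measurable_fun setT (@rV_uncons n).
Proof.
apply: measurable_fun_pair; first exact: measurable_coord.
apply: measurable_fun_rV => i; under eq_fun do rewrite mxE.
exact: (@measurable_coord R n.+1 (rshift 1 i)).
Qed.

Section step.
Context (n : nat) (m : {sigma_finite_measure set 'rV[R]_n -> \bar R}).

Definition lebesgue_rV_step : set 'rV[R]_n.+1 -> \bar R :=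
  pushforward (lebesgue_measure \x m)%E (@rV_cons n).

HB.instance Definition _ := Measure.copy lebesgue_rV_step
  (measure_function_pushforward__canonical__measure_function_Measure
    (lebesgue_measure \x m)%E (@measurable_rV_cons n)).

Let lebesgue_rV_step_sigma_finite : sigma_finite setT lebesgue_rV_step.
Proof.
have /sigma_finiteP[F [TF ndF Foo]] := sigma_finiteT (@lebesgue_measure R).
have /sigma_finiteP[G [TG ndG Goo]] := sigma_finiteT m.
exists (fun k => @rV_uncons n @^-1` (F k `*` G k)).
  apply/esym; rewrite -subTset => x _.
  have [i _ Fi] : (\bigcup_i F i) (rV_uncons x).1 by rewrite -TF.
  have [j _ Gj] : (\bigcup_i G i) (rV_uncons x).2 by rewrite -TG.
  exists (maxn i j) => //; split.
    by move: Fi; exact/subsetPset/ndF/leq_maxl.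
  by move: Gj; exact/subsetPset/ndG/leq_maxr.
move=> k; have [mF Fk] := Foo k; have [mG Gk] := Goo k; split.
  rewrite -[X in measurable X]setTI; apply: measurable_rV_uncons => //.
  exact: measurableX.
rewrite /lebesgue_rV_step /pushforward -comp_preimage.
have -> : @rV_uncons n \o @rV_cons n = id.
  by apply/funext => x /=; rewrite rV_consK.
rewrite preimage_id product_measure1E// lte_mul_pinfty// ge0_fin_numE//.
Qed.

HB.instance Definition _ := Measure_isSigmaFinite.Build _ _ _
  lebesgue_rV_step lebesgue_rV_step_sigma_finite.

End step.

Fixpoint lebesgue_rV (n : nat) : {sigma_finite_measure set 'rV[R]_n -> \bar R} :=
  match n with
  | 0 => [the {sigma_finite_measure set 'rV[R]_0 -> \bar R} of \d_(0 : 'rV[R]_0)]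
  | k.+1 => [the {sigma_finite_measure set 'rV[R]_k.+1 -> \bar R} of
               lebesgue_rV_step (lebesgue_rV k)]
  end.

End lebesgue_rV.

Lemma lebesgue_rV_box (R : realType) n (a b : 'rV[R]_n) :
  (forall i, a ord0 i <= b ord0 i) ->
  lebesgue_rV n [set x | forall i, x ord0 i \in `[a ord0 i, b ord0 i]] =
    (\prod_(i < n) (b ord0 i - a ord0 i))%:E.
Proof.
elim: n a b => [|n IH] a b ab.
  rewrite big_ord0 /= diracE mem_set//= => -[//].
rewrite big_ord_recl /= /lebesgue_rV_step /pushforward.
pose a' := (rV_uncons a).2; pose b' := (rV_uncons b).2.
have a'E i : a' ord0 i = a ord0 (lift ord0 i).
  by rewrite mxE; congr (a _ _); apply/val_inj.
have b'E i : b' ord0 i = b ord0 (lift ord0 i).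
  by rewrite mxE; congr (b _ _); apply/val_inj.
pose B := [set x : 'rV[R]_n | forall i, x ord0 i \in `[a' ord0 i, b' ord0 i]].
have mB : measurable B.
  have -> : B = \bigcap_(i in [set: 'I_n])
      ((fun x : 'rV[R]_n => x ord0 i) @^-1` `[a' ord0 i, b' ord0 i]).
    apply/seteqP; split => x /= Bx i; first by move=> _; exact: Bx.
    exact: (Bx i).
  apply: fin_bigcap_measurable => // i _; rewrite -[X in measurable X]setTI.
  by apply: measurable_coord => //; exact: measurable_itv.
have consE (p : measurableTypeR R * 'rV[R]_n) (i : 'I_n) :
    rV_cons p ord0 (lift ord0 i) = p.2 ord0 i.
  rewrite -[in RHS](rV_consK p) [RHS]mxE.
  by congr (fun_of_matrix (rV_cons p) _ _); apply/val_inj.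
have cons0 (p : measurableTypeR R * 'rV[R]_n) : rV_cons p ord0 ord0 = p.1.
  by rewrite -[in RHS](rV_consK p).
have -> : @rV_cons R n @^-1`
      [set x | forall i, x ord0 i \in `[a ord0 i, b ord0 i]] =
    (`[a ord0 ord0, b ord0 ord0] : set (measurableTypeR R)) `*` B.
  apply/seteqP; split => -[t v] /= tv.
    split; first by have := tv ord0; rewrite cons0.
    by move=> i; have := tv (lift ord0 i); rewrite consE a'E b'E.
  move: tv => [/= t0 vB] i; have [j ->|->] := unliftP ord0 i.
    by rewrite consE -a'E -b'E; exact: vB.
  by rewrite cons0.
rewrite product_measure1E// IH; last by move=> i; rewrite a'E b'E.
rewrite EFinM; congr (_ * _)%E.
  rewrite [LHS]lebesgue_measure_itv /= lte_fin.
  have [_|ba] := ltP; first by rewrite EFinB.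
  by rewrite (@le_anti _ _ (b ord0 ord0) (a ord0 ord0)) ?subrr// ba ab.
by congr (_%:E); apply: eq_bigr => i _; rewrite a'E b'E.
Qed.

Section norms.
Context {R : realType}.

(* The norm `|x| of the library on 'rV[R]_n is the sup norm. *)
Definition enorm n (x : 'rV[R]_n) : R := Num.sqrt (\sum_(i < n) x ord0 i ^+ 2).

Context d (T : measurableType d) (mu : {measure set T -> \bar R}).

(* Extending by 0 outside D does not change the essential supremum of a
   nonnegative function over D, unless D is negligible, in which case the
   norm is 0. *)
Definition Linfty_norm n (D : set T) (f : T -> 'rV[R]_n) : \bar R :=
  Lnorm mu +oo (fun x => if x \in D then (enorm (f x))%:E else 0%E).

Definition sqr_L2_norm n (D : set T) (f : T -> 'rV[R]_n) : \bar R :=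
  (\int[mu]_(x in D) (enorm (f x) ^+ 2)%:E)%E.

End norms.

(* C^1 regularity on a set that need not be open: f is the restriction of a
   C^1 map defined on an open neighbourhood of K. Continuity of the
   differential is expressed pointwise, which is continuity in operator norm
   when V has finite dimension. *)
Definition C1_on (R : realType) (V W : normedModType R) (K : set V)
    (f : V -> W) : Prop :=
  exists (U : set V) (g : V -> W),
    [/\ open U, K `<=` U, (forall x, K x -> f x = g x),
        (forall x, U x -> differentiable g x) &
        (forall v x, U x -> {for x, continuous (fun y => 'd g y v)})].

(* Derivative of u at t relative to D; one-sided if t is an endpoint of the
   interval D. *)
Definition is_deriv_within (R : realType) (V : normedModType R) (D : set R)
    (u : R -> V) (t : R) (v : V) : Prop :=
  (fun s => (s - t)^-1 *: (u s - u t)) @ within D (t^') --> v.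

(* Elements of R^k are row vectors; a map on [t0, T] x P is a total function
   of which only the restriction to [t0, T] x P is meaningful. *)
Section models.
Context {R : realType} (p : nat) (t0 T : R) (P : set 'rV[R]_p).

Definition time_param : set (measurableTypeR R * 'rV[R]_p) :=
  [set x | t0 <= x.1 <= T /\ P x.2].

Definition time_param_measure : {measure set (measurableTypeR R * 'rV[R]_p) -> \bar R} :=
  (@lebesgue_measure R \x lebesgue_rV p)%E.

Definition C1_state k (u : R -> 'rV[R]_p -> 'rV[R]_k) : Prop :=
  @C1_on R (R^o * 'rV[R]_p)%type 'rV[R]_k [set x | t0 <= x.1 <= T /\ P x.2]
    (fun x => u x.1 x.2).

Definition solves_ivp k (f : R -> 'rV[R]_k -> 'rV[R]_p -> 'rV[R]_k)
    (u0 : 'rV[R]_p -> 'rV[R]_k) (u : R -> 'rV[R]_p -> 'rV[R]_k) : Prop :=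
  forall mu, P mu ->
    u t0 mu = u0 mu /\
    forall t, t0 < t <= T ->
      is_deriv_within `[t0, T] (u ^~ mu) t (f t (u t mu) mu).

Definition wellposed_field k (f : R -> 'rV[R]_k -> 'rV[R]_p -> 'rV[R]_k) : Prop :=
  [/\ {within [set x : R * 'rV[R]_k * 'rV[R]_p | t0 <= x.1.1 <= T /\ P x.2],
        continuous (fun x => f x.1.1 x.1.2 x.2)},
      (exists M : R, forall t v mu, t0 <= t <= T -> P mu ->
        enorm (f t v mu) <= M) &
      (forall w : 'rV[R]_k, exists r L : R, 0 < r /\
        forall t mu v1 v2, t0 <= t <= T -> P mu ->
          enorm (v1 - w) < r -> enorm (v2 - w) < r ->
          enorm (f t v1 mu - f t v2 mu) <= L * enorm (v1 - v2))].

Section latent.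
Context (N n : nat) (u0h : 'rV[R]_p -> 'rV[R]_N)
  (uh : R -> 'rV[R]_p -> 'rV[R]_N).

Definition latent_feasible (Psi : 'rV[R]_N -> 'rV[R]_n)
    (fn : R -> 'rV[R]_n -> 'rV[R]_p -> 'rV[R]_n)
    (Psi' : 'rV[R]_n -> 'rV[R]_N) (un : R -> 'rV[R]_p -> 'rV[R]_n) : Prop :=
  [/\ lipschitz Psi', C1_state un & solves_ivp fn (Psi \o u0h) un].

Definition latent_loss (Psi' : 'rV[R]_n -> 'rV[R]_N)
    (un : R -> 'rV[R]_p -> 'rV[R]_n) : \bar R :=
  sqr_L2_norm time_param_measure time_param
    (fun x => uh x.1 x.2 - Psi' (un x.1 x.2)).

(* lipschitz refers to the sup norm, which is equivalent to enorm. *)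
Definition latent_dynamics_model (Psi : 'rV[R]_N -> 'rV[R]_n)
    (Psi' : 'rV[R]_n -> 'rV[R]_N)
    (fn : R -> 'rV[R]_n -> 'rV[R]_p -> 'rV[R]_n)
    (un : R -> 'rV[R]_p -> 'rV[R]_n) : Prop :=
  [/\ lipschitz Psi, latent_feasible Psi fn Psi' un &
      forall Phi' vn, latent_feasible Psi fn Phi' vn ->
        (latent_loss Psi' un <= latent_loss Phi' vn)%E].

End latent.
End models.

(* Every nonempty relatively open subset of P has positive Lebesgue measure,
   e.g. P is the closure of an open set. *)
Definition full_support (R : realType) p (P : set 'rV[R]_p) : Prop :=
  forall O : set 'rV[R]_p, open O -> P `&` O !=set0 ->
    (0 < lebesgue_rV p (P `&` O))%E.

(* Main.v *)
Require Import Defs.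
From mathcomp Require Import all_boot all_order all_algebra.
From mathcomp Require Import all_classical all_reals all_analysis.
From mathcomp Require Import ess_sup_inf measurable_realfun lra.
Import Order.TTheory GRing.Theory Num.Theory.
Import numFieldNormedType.Exports.
Local Open Scope classical_set_scope.
Local Open Scope ring_scope.
Set Implicit Arguments.
Unset Strict Implicit.
Unset Printing Implicit Defensive.

(** Fix a parameter [m] and put [g s = uh s m - Psi' (un s m)].  By the chain
    rule, [g] has derivative [fh - fn J] wherever [Psi'] is differentiable along
    [un].  If this derivative is bounded by the L^oo norm [K1] of the residual,
    a mean value inequality gives [enorm (g t) <= enorm (g t0) + K1 (t - t0)],
    and [g t0] is the initial error [u0h m - Psi' (Psi (u0h m))].

    The difficulty is that every bound is an almost everywhere bound.

    In time, for a fixed [m], the derivative is controlled only outside a null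
    set.  The mean value inequality survives ([enorm_growth]) because [g] grows
    at a uniform rate everywhere, the vector fields being bounded and [Psi']
    Lipschitz.  It is proved without integrating the derivative, by comparing
    [enorm (g t)] with an affine function to which a multiple of the measure of
    [U `&` `[t0, t]] is added, where [U] is an open set of small measure that
    covers the exceptional times ([le_increment], [le_increment_ae]).

    In the parameter, Tonelli's theorem turns the exceptional subset of
    [[t0, T] x P] into null sets of times for almost every [m]
    ([negligible_ysection]), and the bound on the initial error holds for almost
    every [m] as well.  So the estimate holds for almost every [m] in [P].
    Since every nonempty relatively open part of [P] has positive measure, such
    parameters are dense in [P] ([full_support_dense]); and the error at a
    given time is continuous in the parameter, so the estimate extends to all
    of [P]. *)

(** * Increments of real functions *)

(** A continuous [h] cannot outgrow a nondecreasing [psi] if it does not do so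
    just to the right of any interior point: otherwise take the infimum of the
    points where the increment of [h] exceeds that of [psi] by more than [e].
    By left continuity the bound still holds there, and the hypothesis carries
    it further to the right.  Only the monotonicity of [psi] enters, so [psi]
    may contain the measure of an open set, which is how null sets are
    discarded below. *)
Lemma le_increment (R : realType) (h psi : R -> R) (a b : R) :
  a < b -> {within `[a, b], continuous h} ->
  {in `[a, b] &, {homo psi : x y / x <= y}} ->
  (forall c, a < c < b ->
     \forall s \near c^'+, h s - h c <= psi s - psi c) ->
  h b - h a <= psi b - psi a.
Proof.
move=> ab /(continuous_within_itvP _ ab)[hin ha hb] psi_nd step.
apply/ler_addgt0Pr => e e0; rewrite leNgt; apply/negP => bad.
(* The inequality holds up to [e] at [a] and persists on a right neighbourhood
   of [a] by continuity; without this slack the infimum [c] could be [a]. *)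
pose V := [set x | a <= x <= b /\ psi x - psi a + e < h x - h a].
have Vb : V b by split => //; rewrite lexx ltW.
have lbV : lbound V a by move=> x [/andP[]].
have hlV : has_lbound V by exists a.
have hiV : has_inf V by split => //; exists b.
set c := inf V.
have ac0 : a <= c by apply: lb_le_inf => //; exists b.
have cb : c <= b by exact: ge_inf.
have cI : c \in `[a, b] by rewrite in_itv/= ac0 cb.
have before x : a <= x < c -> h x - h a <= psi x - psi a + e.
  move=> /andP[ax xc]; rewrite leNgt; apply/negP => xbad.
  have : c <= x.
    by apply: ge_inf => //; split => //; rewrite ax (le_trans (ltW xc)).
  by rewrite leNgt xc.
have after x : c < x ->
    (forall y, c <= y <= b -> y < x -> h y - h a <= psi y - psi a + e) -> False.
  move=> cx H; have xc0 : 0 < x - c by rewrite subr_gt0.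
  have [y [yI ybad] yx] := inf_adherent xc0 hiV.
  have cy : c <= y by apply: ge_inf.
  have /andP[_ yb] := yI.
  rewrite addrC subrK in yx.
  have := H y; rewrite cy yb => /(_ isT yx).
  by rewrite leNgt ybad.
have aI : a \in `[a, b] by rewrite in_itv/= lexx ltW.
have ac : a < c.
  rewrite lt_neqAle ac0 andbT; apply/eqP => eac.
  move/cvgrPdist_lt : ha => /(_ e e0) [d /= d0 hd].
  apply: (after (a + d)); first by rewrite -eac ltrDl.
  move=> y; rewrite -eac => /andP[ay yb] yd.
  have yI : y \in `[a, b] by rewrite in_itv/= ay.
  have := psi_nd _ _ aI yI ay.
  have [->|ya] := eqVneq y a; first by move=> _; rewrite !subrr add0r ltW.
  have : `|h a - h y| < e.
    apply: hd; last by rewrite lt_neqAle eq_sym ya ay.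
    by rewrite /= distrC ger0_norm ?subr_ge0// ltrBlDl.
  by rewrite ltr_norml => /andP[? ?] ?; lra.
have hcl : h s @[s --> c^'-] --> h c.
  have [cltb|] := ltP c b.
    by apply: cvg_at_left_filter; apply: hin; rewrite in_itv/= ac.
  by move=> bc; rewrite (_ : c = b)//; apply/eqP; rewrite eq_le cb bc.
have cgood : h c - h a <= psi c - psi a + e.
  rewrite leNgt; apply/negP => cbad.
  pose e' := h c - h a - (psi c - psi a + e).
  have e'0 : 0 < e' by rewrite subr_gt0.
  move/cvgrPdist_lt : hcl => /(_ e' e'0) [d /= d0 hd].
  pose y := Num.max a (c - d / 2).
  have ay : a <= y by rewrite /y le_max lexx.
  have yc : y < c by rewrite /y gt_max ac/= ltrBlDr ltrDl divr_gt0.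
  have yI : y \in `[a, b] by rewrite in_itv/= ay (le_trans (ltW yc)).
  have : `|h c - h y| < e'.
    apply: hd => //=; rewrite gtr0_norm ?subr_gt0//.
    have : c - d/2 <= y by rewrite /y le_max lexx orbT.
    by move=> ?; lra.
  have yg := before y; rewrite ay yc in yg; have {}yg := yg isT.
  have := psi_nd _ _ yI cI (ltW yc).
  by rewrite ltr_norml /e' => ? /andP[? ?]; lra.
have [cltb|bc] := ltP c b; last first.
  have ecb : c = b by apply/eqP; rewrite eq_le cb bc.
  by move: cgood; rewrite ecb leNgt bad.
have acb : a < c < b by rewrite ac.
have [d /= d0 hd] := step c acb.
apply: (after (c + d)); first by rewrite ltrDl.
move=> y /andP[cy yb] yd.
move: cy; rewrite le_eqVlt => /predU1P[<-//|cy].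
have : h y - h c <= psi y - psi c.
  by apply: hd => //=; rewrite distrC gtr0_norm ?subr_gt0// ltrBlDl.
by move=> ?; lra.
Qed.

(** A growth rate that holds almost everywhere controls the increment, as soon
    as some rate [L], however bad, holds everywhere.  Cover the null set [E] by
    an open set [U] of measure at most [d]: points of [E] lie in the interior
    of [U], where the measure of [U `&` `[a, t]] grows with slope 1 and pays for
    the rate [L]; the total cost is [L * d], and [d] is arbitrary. *)
Lemma le_increment_ae (R : realType) (h : R -> R) (a b K L : R)
    (E : set (measurableTypeR R)) :
  a < b -> 0 <= K -> 0 <= L -> (@lebesgue_measure R).-negligible E ->
  {within `[a, b], continuous h} ->
  (forall c, a < c < b ->
     \forall s \near c^'+, h s - h c <= L * (s - c)) ->
  (forall c, a < c < b -> ~ E c -> forall e, 0 < e ->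
     \forall s \near c^'+, h s - h c <= (K + e) * (s - c)) ->
  h b - h a <= K * (b - a).
Proof.
move=> ab K0 L0 [A [mA A0 EA]] hc hL hK.
apply/ler_addgt0Pr => e e0.
(* [d] is both the excess slope and the measure of [U], for a total error
   [d * (b - a) + L * d], which is less than [e]. *)
pose d := e / (b - a + L + 1).
have D0 : 0 < b - a + L + 1 by move: ab; rewrite -subr_gt0 => ?; lra.
have d0 : 0 < d by rewrite divr_gt0.
have Afin : (lebesgue_measure A < +oo)%E.
  by rewrite (_ : lebesgue_measure A = 0%E) ?ltry//; exact: A0.
have [U [oU AU UA]] := lebesgue_regularity_outer mA Afin d0.
have mU : measurable (U : set (measurableTypeR R)) by exact: open_measurable.
have Ud : (lebesgue_measure U <= d%:E)%E.
  rewrite -(setDUK AU) setUC; apply: (le_trans (measureU2 _ _ _)) => //.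
    exact: measurableD.
  rewrite [X in (_ + X)%E](_ : _ = 0%E) ?adde0; first exact: ltW.
  exact: A0.
have mUI t : measurable (U `&` `[a, t] : set (measurableTypeR R)).
  exact: measurableI.
have mUId t : (lebesgue_measure (U `&` `[a, t]) <= d%:E)%E.
  by apply: le_trans Ud; apply: le_measure; rewrite ?inE.
pose phi t := fine (lebesgue_measure (U `&` `[a, t] : set (measurableTypeR R))).
have fin t :
    lebesgue_measure (U `&` `[a, t] : set (measurableTypeR R)) \is a fin_num.
  rewrite ge0_fin_numE//; exact: le_lt_trans (mUId t) (ltry _).
have phiE t : (phi t)%:E =
    lebesgue_measure (U `&` `[a, t] : set (measurableTypeR R)).
  by rewrite /phi fineK.
have phi0 t : 0 <= phi t by exact: fine_ge0.
have phid t : phi t <= d by rewrite -lee_fin phiE.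
have phi_nd s t : s <= t -> phi s <= phi t.
  move=> st; rewrite -lee_fin !phiE le_measure ?inE//.
  by apply: setIS; apply: subset_itvl; rewrite bnd_simp.
have phi_slope s t :
    a <= s -> s < t -> `]s, t] `<=` U -> t - s <= phi t - phi s.
  move=> sa st stU; rewrite lerBrDr addrC -lee_fin EFinD !phiE.
  have -> : (t - s)%:E = lebesgue_measure (`]s, t] : set (measurableTypeR R)).
    by rewrite lebesgue_measure_itv/= lte_fin st EFinB.
  rewrite -measureU//; last first.
    apply/seteqP; split => // x [[_ /=]].
    rewrite !in_itv/= => /andP[_ xs] /andP[sx _].
    by move: sx; rewrite ltNge xs.
  apply: le_measure; rewrite ?inE//.
    by apply: measurableU.
  move=> x [[Ux]|].
    rewrite /= !in_itv/= => /andP[ax xs]; split => //.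
    by rewrite ax (le_trans xs)// ltW.
  move=> xst; split; first exact: stU.
  move: xst; rewrite /= !in_itv/= => /andP[sx ->].
  by rewrite andbT (le_trans sa)// ltW.
pose psi t := (K + d) * t + L * phi t.
have Kd : 0 <= K + d by rewrite addr_ge0// ltW.
have : h b - h a <= psi b - psi a.
  apply: le_increment => //.
    by move=> x y _ _ xy; rewrite lerD// ler_wpM2l// phi_nd.
  move=> c acb; have /andP[ac cb] := acb.
  have [Ec|nEc] := pselect (U c); last first.
    have nEc' : ~ E c by move=> /EA/AU.
    near=> s.
    have cs : c <= s by near: s; exact: nbhs_right_ge.
    have : h s - h c <= (K + d) * (s - c) by near: s; apply: hK.
    have := phi_nd _ _ cs; move=> /(ler_wpM2l L0).
    by rewrite /psi => ? ?; lra.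
  have [r /= r0 rU] : nbhs c U by apply: open_nbhs_nbhs.
  near=> s.
  have cs : c < s by near: s; exact: nbhs_right_gt.
  have : h s - h c <= L * (s - c) by near: s; apply: hL.
  have : s - c <= phi s - phi c.
    apply: phi_slope => //; first exact: ltW.
    move=> y; rewrite /= in_itv/= => /andP[cy ys]; apply: rU => /=.
    rewrite distrC gtr0_norm ?subr_gt0// ltrBlDl (le_lt_trans ys)//.
    by near: s; apply: nbhs_right_lt; rewrite ltrDl.
  move=> /(ler_wpM2l L0).
  have : 0 <= (K + d) * (s - c) by rewrite mulr_ge0// subr_ge0 ltW.
  by rewrite /psi => ? ? ?; lra.
move=> /le_trans; apply; rewrite /psi.
have -> : (K + d) * b + L * phi b - ((K + d) * a + L * phi a) =
  K * (b - a) + (d * (b - a) + L * (phi b - phi a)) by lra.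
rewrite lerD2l.
have : L * (phi b - phi a) <= L * d.
  by rewrite ler_wpM2l// (le_trans _ (phid b))// lerBlDr lerDl.
have : d * (b - a + L + 1) = e by rewrite /d divfK// gt_eqF.
by move=> ? ?; lra.
Unshelve. all: by end_near. Qed.

(** * Curves in Euclidean space *)

Section enorm_theory.
Context {R : realType} {n : nat}.
Implicit Types x y : 'rV[R]_n.

Lemma enorm_ge0 x : 0 <= enorm x. Proof. exact: sqrtr_ge0. Qed.

Lemma sqr_enorm x : enorm x ^+ 2 = \sum_(i < n) x ord0 i ^+ 2.
Proof. by rewrite sqr_sqrtr// sumr_ge0// => i _; exact: sqr_ge0. Qed.

Lemma enormZ (a : R) x : enorm (a *: x) = `|a| * enorm x.
Proof.
rewrite /enorm; under eq_bigr do rewrite mxE exprMn.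
by rewrite -mulr_sumr sqrtrM ?sqr_ge0// sqrtr_sqr.
Qed.

Lemma enorm0_eq0 x : enorm x = 0 -> x = 0.
Proof.
move=> x0; have := sqr_enorm x; rewrite x0 expr0n /= => /esym/eqP.
rewrite psumr_eq0 => [/allP xi0|i _]; last exact: sqr_ge0.
apply/rowP => i; rewrite mxE.
by have := xi0 i (mem_index_enum _); rewrite sqrf_eq0 => /eqP.
Qed.

(** Cauchy-Schwarz, from the nonnegativity of the squared length of
    [enorm y *: x - enorm x *: y]. *)
Lemma dot_le_enorm x y : \sum_(i < n) x ord0 i * y ord0 i <= enorm x * enorm y.
Proof.
have [/eqP|x0] := eqVneq (enorm x) 0.
  move=> /eqP /enorm0_eq0 ->; rewrite big1 ?mulr_ge0 ?enorm_ge0// => i _.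
  by rewrite mxE mul0r.
have [/eqP|y0] := eqVneq (enorm y) 0.
  move=> /eqP /enorm0_eq0 ->; rewrite big1 ?mulr_ge0 ?enorm_ge0// => i _.
  by rewrite mxE mulr0.
have xy0 : 0 < enorm x * enorm y by rewrite mulr_gt0// lt0r ?x0 ?y0 enorm_ge0.
rewrite -(ler_pM2l xy0).
have : 0 <= \sum_(i < n) (enorm y * x ord0 i - enorm x * y ord0 i) ^+ 2.
  by apply: sumr_ge0 => i _; exact: sqr_ge0.
under eq_bigr do rewrite sqrrB !exprMn.
rewrite big_split sumrB /= sumrMnl -!mulr_sumr -!sqr_enorm.
under [X in X *+ 2]eq_bigr do rewrite mulrACA.
rewrite -mulr_sumr -mulr_natr.
set s := \sum_(i < n) _ => ?; lra.
Qed.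

Lemma ler_enormD x y : enorm (x + y) <= enorm x + enorm y.
Proof.
rewrite -(ler_pXn2r (n := 2)) ?nnegrE ?addr_ge0 ?enorm_ge0//.
rewrite sqrrD !sqr_enorm; under eq_bigr do rewrite mxE sqrrD.
rewrite !big_split /= -mulr2n lerD2r lerD2l ler_wMn2r//.
exact: dot_le_enorm.
Qed.

Lemma enorm_mxnorm x : enorm x <= Num.sqrt n%:R * `|x|.
Proof.
rewrite -(ler_pXn2r (n := 2)) ?nnegrE ?mulr_ge0 ?enorm_ge0 ?sqrtr_ge0//.
rewrite exprMn sqr_enorm sqr_sqrtr//.
apply: (@le_trans _ _ (\sum_(i < n) `|x| ^+ 2)).
  apply: ler_sum => i _; rewrite -(real_normK (num_real _)).
  rewrite ler_pXn2r ?nnegrE// [leRHS]mx_normrE.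
  exact: (le_bigmax 0 (fun ij => `|x ij.1 ij.2|) (ord0, i)).
by rewrite sumr_const card_ord mulr_natl.
Qed.

Lemma mxnorm_enorm x : `|x| <= enorm x.
Proof.
rewrite /Num.norm/=.
have [->|/mx_norm_neq0[[i j] ->]] := eqVneq (mx_norm x) 0.
  by move=> /=; exact: enorm_ge0.
rewrite /= (ord1 i) -sqrtr_sqr ler_wsqrtr// (bigD1 j)//= lerDl.
by apply: sumr_ge0 => k _; exact: sqr_ge0.
Qed.

End enorm_theory.

(** One-sided differentiability as a first-order expansion rather than as a
    limit of difference quotients: this is the form that composes with a
    differentiable map without dividing by a vanishing increment, and that
    bounds increments directly. *)
Definition right_deriv (R : realType) (V : normedModType R) (u : R -> V)
    (t : R) (v : V) : Prop :=
  forall e, 0 < e ->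
    \forall s \near t^'+, `|u s - u t - (s - t) *: v| <= e * (s - t).

Section right_deriv.
Context {R : realType}.

Lemma right_deriv_within (V : normedModType R) (a b t : R) (u : R -> V) (v : V) :
  a <= t < b -> is_deriv_within `[a, b] u t v -> right_deriv u t v.
Proof.
move=> /andP[at_ tb] /cvgrPdist_le du e e0.
have := du e e0; rewrite /within/= => -[d /= d0 hd].
near=> s.
have ts : t < s by near: s; exact: nbhs_right_gt.
have st0 : 0 < s - t by rewrite subr_gt0.
have : `|v - (s - t)^-1 *: (u s - u t)| <= e.
  apply: hd => /=.
  - rewrite distrC gtr0_norm// ltrBlDl.
    by near: s; apply: nbhs_right_lt; rewrite ltrDl.
  - by rewrite gt_eqF.
  - rewrite in_itv/= (le_trans at_ (ltW ts))/=.
    by near: s; exact: nbhs_right_le.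
rewrite -(ler_pM2r st0); apply: le_trans.
have -> : u s - u t - (s - t) *: v =
    - ((s - t) *: (v - (s - t)^-1 *: (u s - u t))).
  by rewrite scalerBr scalerA mulfV ?gt_eqF// scale1r opprB.
by rewrite normrN normrZ gtr0_norm// mulrC.
Unshelve. all: by end_near. Qed.

Lemma right_derivB (V : normedModType R) (u w : R -> V) (t : R) (du dw : V) :
  right_deriv u t du -> right_deriv w t dw ->
  right_deriv (fun s => u s - w s) t (du - dw).
Proof.
move=> hu hw e e0; have e2 : 0 < e / 2 by rewrite divr_gt0.
near=> s.
have : `|u s - u t - (s - t) *: du| <= e / 2 * (s - t) by near: s; exact: hu.
have : `|w s - w t - (s - t) *: dw| <= e / 2 * (s - t) by near: s; exact: hw.
move=> h1 h2.
have -> : u s - w s - (u t - w t) - (s - t) *: (du - dw) =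
    (u s - u t - (s - t) *: du) - (w s - w t - (s - t) *: dw).
  by rewrite scalerBr !opprD !opprK [X in X + _ = _]addrACA [LHS]addrACA.
apply: (le_trans (ler_normB _ _)).
by apply: (le_trans (lerD h2 h1)); lra.
Unshelve. all: by end_near. Qed.

Lemma right_deriv_le (V : normedModType R) (u : R -> V) (t : R) (v : V) (M : R) :
  right_deriv u t v -> `|v| < M ->
  \forall s \near t^'+, `|u s - u t| <= M * (s - t).
Proof.
move=> du vM; have e0 : 0 < M - `|v| by rewrite subr_gt0.
near=> s.
have ts : t < s by near: s; exact: nbhs_right_gt.
have : `|u s - u t - (s - t) *: v| <= (M - `|v|) * (s - t) by near: s; exact: du.
have := ler_normD (u s - u t - (s - t) *: v) ((s - t) *: v).
rewrite subrK normrZ gtr0_norm ?subr_gt0// => ? ?; lra.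
Unshelve. all: by end_near. Qed.

Lemma right_deriv_cvg (V : normedModType R) (u : R -> V) (t : R) (v : V) :
  right_deriv u t v -> u s @[s --> t^'+] --> u t.
Proof.
move=> du; apply/cvgrPdist_lt => e e0.
have M0 : 0 < `|v| + 1 by rewrite ltr_pwDr.
near=> s.
have ts : t < s by near: s; exact: nbhs_right_gt.
have h : `|u s - u t| <= (`|v| + 1) * (s - t).
  by near: s; apply: (right_deriv_le du); rewrite ltrDl.
rewrite distrC (le_lt_trans h)// mulrC -ltr_pdivlMr// ltrBlDl.
by near: s; apply: nbhs_right_lt; rewrite ltrDl divr_gt0.
Unshelve. all: by end_near. Qed.

(** Chain rule.  The error of the outer expansion is small relative to the
    increment of [u], which is [O(s - t)]; the inner error passes through the
    bounded linear map ['d f (u t)]. *)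
Lemma right_deriv_comp (V W : normedModType R) (u : R -> V) (f : V -> W)
    (t : R) (v : V) :
  right_deriv u t v -> differentiable f (u t) ->
  right_deriv (f \o u) t ('d f (u t) v).
Proof.
move=> du df e e0.
have dcont : continuous ('d f (u t)) by exact: diff_continuous.
have /linear_bounded_continuous/linear_boundedP [C0 [_ hC]] := dcont.
pose C := Num.max (C0 + 1) 1.
have CP x : `|'d f (u t) x| <= C * `|x|.
  apply: hC; rewrite /C lt_max ltrDl ltr01 //.
have C1 : 1 <= C by rewrite /C le_max lexx orbT.
have C_gt0 : 0 < C by exact: lt_le_trans C1.
pose M := `|v| + 1.
have M0 : 0 < M by rewrite /M ltr_pwDr.
have eM0 : 0 < e / 2 / M by rewrite !divr_gt0.
have eC0 : 0 < e / 2 / C by rewrite !divr_gt0.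
have fo : \forall h \near (0 : V),
    `|f (h + u t) - f (u t) - 'd f (u t) h| <= e / 2 / M * `|h|.
  near=> h; rewrite (diff_locallyx df) -addrA -opprD addrC addKr.
  near: h; exact: littleoP.
have ut0 : u s - u t @[s --> t^'+] --> (0 : V).
  by apply/subr_cvg0; exact: right_deriv_cvg du.
near=> s.
have ts : t < s by near: s; exact: nbhs_right_gt.
have us : `|u s - u t| <= M * (s - t).
  by near: s; apply: (right_deriv_le du); rewrite ltrDl.
have hs : `|u s - u t - (s - t) *: v| <= e / 2 / C * (s - t).
  by near: s; exact: du.
have : `|f (u s - u t + u t) - f (u t) - 'd f (u t) (u s - u t)| <=
    e / 2 / M * `|u s - u t|.
  by near: s; exact: (ut0 _ fo).
rewrite subrK => fs.
have -> : (f \o u) s - (f \o u) t - (s - t) *: 'd f (u t) v =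
  (f (u s) - f (u t) - 'd f (u t) (u s - u t)) +
  'd f (u t) (u s - u t - (s - t) *: v).
  have dZ : 'd f (u t) ((s - t) *: v) = (s - t) *: 'd f (u t) v.
    by rewrite linearZ.
  by rewrite (raddfB ('d f (u t)) (u s - u t)) /= dZ addrA subrK.
apply: (le_trans (ler_normD _ _)).
have h1 : e / 2 / M * `|u s - u t| <= e / 2 * (s - t).
  by rewrite -mulrA ler_pM2l ?divr_gt0// mulrC ler_pdivrMr// mulrC.
have h2 : C * `|u s - u t - (s - t) *: v| <= e / 2 * (s - t).
  apply: (le_trans (ler_wpM2l (ltW C_gt0) hs)).
  by rewrite mulrA mulrC [C * _]mulrC divfK ?gt_eqF// mulrC.
have := CP (u s - u t - (s - t) *: v).
by move=> ?; lra.
Unshelve. all: by end_near. Qed.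
End right_deriv.

Section continuity.
Context {R : realType}.

Lemma lipschitz_continuous (V W : normedModType R) (f : V -> W) (k : R) :
  (forall x y, `|f x - f y| <= k * `|x - y|) -> continuous f.
Proof.
move=> fk x; apply/cvgrPdist_lt => e e0.
have k1 : 0 < `|k| + 1 by rewrite ltr_pwDr.
near=> y; apply: (le_lt_trans (fk _ _)).
have yx : `|x - y| < e / (`|k| + 1).
  near: y; apply: (@cvgr_dist_lt _ _ _ (nbhs x) _ id x) => //.
  by rewrite divr_gt0.
apply: (@le_lt_trans _ _ ((`|k| + 1) * `|x - y|)).
  by rewrite ler_wpM2r// (le_trans (ler_norm k))// lerDl.
by rewrite mulrC -ltr_pdivlMr.
Unshelve. all: by end_near. Qed.

Lemma lipschitzP (V W : normedModType R) (f : V -> W) :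
  lipschitz f -> exists k, 0 <= k /\ forall x y, `|f x - f y| <= k * `|x - y|.
Proof.
move=> [M [_ hM]]; exists (`|M| + 1); split => [|x y]; first by rewrite addr_ge0.
by apply: (hM _ _ (x, y)) => //; rewrite (le_lt_trans (ler_norm M))// ltrDl.
Qed.

Lemma enorm_continuous n : continuous (@enorm R n).
Proof.
apply: (@lipschitz_continuous 'rV[R]_n R^o _ (Num.sqrt n%:R)) => x y.
have := ler_enormD (x - y) y; rewrite subrK => h1.
have := ler_enormD (y - x) x; rewrite subrK => h2.
have := enorm_mxnorm (x - y); have := enorm_mxnorm (y - x); rewrite distrC.
move=> h3 h4; rewrite [`|_|]/Num.norm /= ler_norml; apply/andP; split; lra.
Qed.

Lemma C1_on_continuous (V W : normedModType R) (K : set V) (f : V -> W) x :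
  C1_on K f -> K x -> f y @[y --> within K (nbhs x)] --> f x.
Proof.
move=> [U [g [oU KU fg dg _]]] Kx; rewrite fg//.
have gx : g y @[y --> within K (nbhs x)] --> g x.
  by apply: cvg_within_filter; apply: differentiable_continuous; exact/dg/KU.
apply: cvg_trans gx; apply: near_eq_cvg.
by rewrite near_withinE; apply: nearW => y Ky; rewrite fg.
Qed.

Lemma cvg_within_comp (X Y Z : topologicalType) (A : set X) (K : set Y)
    (phi : X -> Y) (f : Y -> Z) (x : X) :
  phi y @[y --> x] --> phi x -> (forall y, A y -> K (phi y)) ->
  f y @[y --> within K (nbhs (phi x))] --> f (phi x) ->
  f (phi y) @[y --> within A (nbhs x)] --> f (phi x).
Proof.
move=> cphi AK cf S nS.
change (nbhs x [set y | A y -> S (f (phi y))]).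
have : nbhs x (phi @^-1` [set y | K y -> S (f y)]) := cphi _ (cf S nS).
by apply: filterS => y /= KS Ay; exact/KS/AK.
Qed.

End continuity.

(** Mean value inequality for curves whose derivative is bounded almost
    everywhere only.  The function to which [le_increment_ae] applies is
    [s |-> enorm (g s)]: by the triangle inequality its increments are at most
    the norms of those of [g], so a bound on the derivative of [g] carries over
    even where [g] vanishes and the norm is not differentiable. *)
Lemma enorm_growth (R : realType) n (g : R -> 'rV[R]_n) (a b K M : R)
    (E : set (measurableTypeR R)) :
  a < b -> 0 <= K -> 0 <= M -> (@lebesgue_measure R).-negligible E ->
  {within `[a, b], continuous g} ->
  (forall c, a < c < b -> \forall s \near c^'+, `|g s - g c| <= M * (s - c)) ->
  (forall c, a < c < b -> ~ E c ->
     exists2 v, right_deriv g c v & enorm v <= K) ->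
  enorm (g b) <= enorm (g a) + K * (b - a).
Proof.
move=> ab K0 M0 E0 cg gM gK; rewrite -lerBlDl.
pose C := Num.sqrt n%:R : R.
have C0 : 0 <= C by exact: sqrtr_ge0.
have enormB x y : enorm x - enorm y <= enorm (x - y :> 'rV[R]_n).
  by rewrite lerBlDr; have := ler_enormD (x - y) y; rewrite subrK.
apply: (@le_increment_ae R (fun s => enorm (g s)) a b K (C * M) E) => //.
- by rewrite mulr_ge0.
- move=> x; apply: (@continuous_comp (subspace `[a, b]) _ _ g (@enorm R n)).
    exact: cg.
  exact: enorm_continuous.
- move=> c acb; near=> s.
  apply: (le_trans (enormB _ _)); apply: (le_trans (enorm_mxnorm _)).
  by rewrite -mulrA ler_wpM2l//; near: s; exact: gM.
- move=> c acb nEc e e0; have [v gv vK] := gK c acb nEc.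
  have C1 : 0 < C + 1 by rewrite ltr_wpDl.
  have eC : 0 < e / (C + 1) by rewrite divr_gt0.
  near=> s.
  have cs : 0 < s - c by rewrite subr_gt0; near: s; exact: nbhs_right_gt.
  have hs : `|g s - g c - (s - c) *: v| <= e / (C + 1) * (s - c).
    by near: s; exact: gv.
  apply: (le_trans (enormB _ _)).
  have := ler_enormD (g s - g c - (s - c) *: v) ((s - c) *: v).
  rewrite subrK enormZ gtr0_norm// => /le_trans; apply.
  rewrite [leRHS]mulrDl addrC lerD//; first by rewrite mulrC ler_wpM2r// ltW.
  apply: (le_trans (enorm_mxnorm _)).
  apply: (le_trans (ler_wpM2l C0 hs)); rewrite mulrA ler_wpM2r ?(ltW cs)//.
  by rewrite mulrA ler_pdivrMr// mulrC ler_pM2l// lerDl.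
Unshelve. all: by end_near. Qed.

(** * Null sets, density and the essential supremum *)

(** The sigma-algebra is generated by the coordinates, so openness has to be
    reduced to coordinates: an open set is a countable union of sup-norm balls,
    which are boxes, with rational centres and radii [1 / k.+1]. *)
Lemma open_measurable_rV (R : realType) n (O : set 'rV[R]_n) :
  open O -> measurable O.
Proof.
move=> oO.
pose box (q : 'rV[rat]_n * nat) : set 'rV[R]_n :=
  @ball R 'rV[R]_n (map_mx ratr q.1) q.2.+1%:R^-1.
have mbox q : measurable (box q).
  have -> : box q = \bigcap_(i in [set: 'I_n])
      ((fun x : 'rV[R]_n => x ord0 i : measurableTypeR R) @^-1`
         (ball (ratr (q.1 ord0 i) : R) q.2.+1%:R^-1 : set (measurableTypeR R))).
    apply/seteqP; split => [x [_ qx] i _|x qx].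
      by have := qx ord0 i; rewrite mxE.
    by split => [|i j]; rewrite ?invr_gt0// (ord1 i) mxE; exact: qx.
  apply: fin_bigcap_measurable => // i _; rewrite -[X in measurable X]setTI.
  apply: measurable_coord => //; apply: open_measurable; exact: ball_open.
have -> : O = \bigcup_q (if pselect (box q `<=` O) then box q else set0).
  apply/seteqP; split => [x Ox|x [q _]]; last by case: pselect => //= qO /qO.
  have /nbhs_ballP[e /= e0 eO] : nbhs x O by exact: open_nbhs_nbhs.
  have [k ke] : exists k : nat, k.+1%:R^-1 < e / 2.
    have e2 : 0 < e / 2 by rewrite divr_gt0.
    have [k _ hk] := near_infty_natSinv_lt (PosNum e2).
    by exists k; apply: (hk k) => /=.
  have k0 : 0 < k.+1%:R^-1 :> R by rewrite invr_gt0.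
  have /choice[q qP] (i : 'I_n) :
      exists q : rat, ball (ratr q : R) k.+1%:R^-1 (x ord0 i).
    have xk : x ord0 i - k.+1%:R^-1 < x ord0 i by rewrite ltrBlDr ltrDl.
    have [q] := rat_in_itvoo xk; rewrite in_itv/= => /andP[xq qx]; exists q.
    by rewrite /ball/= distrC gtr0_norm ?subr_gt0// ltrBlDr -ltrBlDl.
  have xbox : box (\row_i q i, k) x.
    by split=> // i j; rewrite (ord1 i) !mxE; exact: qP.
  exists (\row_i q i, k) => //; case: pselect => // -[] y yq.
  apply: eO; rewrite [e]splitr; apply: (@le_ball _ _ _ (k.+1%:R^-1 + k.+1%:R^-1)).
    by rewrite lerD// ltW.
  by apply: ball_triangle yq; exact: ball_sym.
apply: countable_bigcupT_measurable; first exact: countableP.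
move=> q; case: (pselect _) => ?; [exact: mbox|exact: measurable0].
Qed.

(** [P `&` O] has positive measure, hence is not contained in the null set
    where the property fails.  Compactness makes [P] closed, hence [P `&` O]
    measurable, which the monotonicity of the measure requires. *)
Lemma full_support_dense (R : realType) p (P A : set 'rV[R]_p) :
  compact P -> full_support P ->
  {ae lebesgue_rV p, forall x, P x -> A x} ->
  forall O : set 'rV[R]_p, open O -> P `&` O !=set0 ->
  exists x, [/\ P x, O x & A x].
Proof.
move=> cP fP [B [mB B0 AB]] O oO PO; apply: contrapT => noA.
have mP : measurable P.
  rewrite -[P]setCK; apply: measurableC; apply: open_measurable_rV.
  by apply: closed_openC; apply: compact_closed => //; exact: norm_hausdorff.
have := fP O oO PO; rewrite ltNge => /negP; apply.
rewrite -[leRHS](_ : lebesgue_rV p B = 0%E)//.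
apply: le_measure; rewrite ?inE//.
  by apply: measurableI => //; exact: open_measurable_rV.
move=> x [Px Ox]; apply: AB => /= /(_ Px) Ax.
by apply: noA; exists x.
Qed.

(** By Tonelli, the measures of the sections of a null set integrate to 0. *)
Lemma negligible_ysection d1 d2 (T1 : measurableType d1) (T2 : measurableType d2)
    (R : realType) (m1 : {sigma_finite_measure set T1 -> \bar R})
    (m2 : {sigma_finite_measure set T2 -> \bar R}) (A : set (T1 * T2)) :
  (m1 \x m2)%E.-negligible A -> {ae m2, forall y, m1.-negligible (ysection A y)}.
Proof.
move=> [B [mB B0 AB]].
have mBy := measurable_fun_ysection m1 mB.
have : (\int[m2]_(y in setT) `|(m1 \o ysection B) y|)%E = 0%E.
  under eq_integral => y _ do rewrite /= gee0_abs//.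
  transitivity ((m1 \x m2)%E B) => //.
  rewrite /product_measure1.
  have := indic_fubini_tonelli m1 m2 mB.
  by rewrite indic_fubini_tonelli_FE// indic_fubini_tonelli_GE// => <-.
move/(ae_eq_integral_abs m2 measurableT mBy).
apply: filterS => y /(_ I) /= By0.
exists (ysection B y); split => //; first exact: measurable_ysection.
by apply: le_ysection.
Qed.

Lemma Linfty_norm_ge0 (R : realType) n d (T : measurableType d)
    (mu : {measure set T -> \bar R}) (D : set T) (f : T -> 'rV[R]_n) :
  (0 <= Linfty_norm mu D f)%E.
Proof. exact: Lnorm_ge0. Qed.

(** The essential supremum is an infimum of almost everywhere upper bounds, and
    is attained as such a bound because it is the limit of a sequence of them.
    If the ambient measure is zero, the norm is 0 by convention and every
    property holds almost everywhere. *)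
Lemma ae_le_Linfty_norm (R : realType) n d (T : measurableType d)
    (mu : {measure set T -> \bar R}) (D : set T) (f : T -> 'rV[R]_n) :
  {ae mu, forall x, D x -> ((enorm (f x))%:E <= Linfty_norm mu D f)%E}.
Proof.
rewrite /Linfty_norm unlock.
case: ifPn => [_|].
  set g := (g in _ \o g).
  apply: filterS (ess_sup_ge mu (abse \o g)) => x /=.
  by move=> + Dx; rewrite /g mem_set// abse_EFin ger0_norm// sqrtr_ge0.
rewrite -leNgt measure_le0 => /eqP mu0.
by exists setT; split.
Qed.

(** * The reduction error *)

Section C1_state_continuity.
Context (R : realType) (p : nat) (t0 T : R) (P : set 'rV[R]_p).

Lemma C1_state_continuous_time k (u : R -> 'rV[R]_p -> 'rV[R]_k)
    (m : 'rV[R]_p) :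
  C1_state t0 T P u -> P m -> {within `[t0, T], continuous (u ^~ m)}.
Proof.
move=> Cu Pm; apply/subspace_continuousP => t /=; rewrite in_itv/= => tI.
apply: (@cvg_within_comp R (R^o * 'rV[R]_p)%type 'rV[R]_k `[t0, T]
  [set x | t0 <= x.1 <= T /\ P x.2] (fun s => (s, m)) (fun x => u x.1 x.2)).
- move=> S [[A B] /= [At Bm] AB]; apply: filterS At => s As.
  by apply: AB; split => //=; exact: nbhs_singleton.
- by move=> s /=; rewrite in_itv.
- by apply: C1_on_continuous.
Qed.

Lemma C1_state_cvg_param k (u : R -> 'rV[R]_p -> 'rV[R]_k) (t : R)
    (m : 'rV[R]_p) :
  C1_state t0 T P u -> t0 <= t <= T -> P m ->
  u t x @[x --> within P (nbhs m)] --> u t m.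
Proof.
move=> Cu tI Pm.
apply: (@cvg_within_comp 'rV[R]_p (R^o * 'rV[R]_p)%type 'rV[R]_k P
  [set x | t0 <= x.1 <= T /\ P x.2] (fun m => (t, m)) (fun x => u x.1 x.2)).
- move=> S [[A B] /= [At Bm] AB]; apply: filterS Bm => x Bx.
  by apply: AB; split => //=; exact: nbhs_singleton.
- by [].
- by apply: C1_on_continuous.
Qed.

End C1_state_continuity.

Lemma right_deriv_solution (R : realType) p k (t0 T : R) (P : set 'rV[R]_p)
    (f : R -> 'rV[R]_k -> 'rV[R]_p -> 'rV[R]_k) u0 u m c :
  solves_ivp t0 T P f u0 u -> P m -> t0 < c < T ->
  right_deriv (u ^~ m) c (f c (u c m) m).
Proof.
move=> su Pm /andP[t0c cT]; have [_ du] := su m Pm.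
apply: (@right_deriv_within _ _ t0 T); first by rewrite (ltW t0c).
by apply: du; rewrite t0c ltW.
Qed.

(** The chain rule identifies the right derivative of the error
    [uh - Psi (un)] with the residual [fh - J fn] outside [E].  On [E], where
    [Psi] may fail to be differentiable, the boundedness of the two vector
    fields and the Lipschitz constant of [Psi] still give a uniform rate. *)
Lemma error_growth (R : realType) (p N n : nat) (t0 T K : R)
    (P : set 'rV[R]_p) fh (u0h : 'rV[R]_p -> 'rV[R]_N) uh
    (Psi : 'rV[R]_n -> 'rV[R]_N) fn u0n un (m : 'rV[R]_p)
    (E : set (measurableTypeR R)) :
  0 <= K ->
  wellposed_field t0 T P fh -> wellposed_field t0 T P fn ->
  C1_state t0 T P uh -> C1_state t0 T P un ->
  solves_ivp t0 T P fh u0h uh -> solves_ivp t0 T P fn u0n un ->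
  lipschitz Psi -> P m -> (@lebesgue_measure R).-negligible E ->
  (forall t, t0 <= t <= T -> ~ E t -> differentiable Psi (un t m) /\
    enorm (fh t (uh t m) m - fn t (un t m) m *m 'J Psi (un t m)) <= K) ->
  forall t, t0 <= t <= T ->
    enorm (uh t m - Psi (un t m)) <=
    enorm (uh t0 m - Psi (un t0 m)) + K * (t - t0).
Proof.
move=> K0 [_ [Mh fhM] _] [_ [Mn fnM] _] Ch Cn sh sn.
move=> /lipschitzP[k [k0 Psik]] Pm E0 good.
move=> t /andP[]; rewrite le_eqVlt => /predU1P[<- _|t0t tT].
  by rewrite subrr mulr0 addr0.
have t0T : t0 < T by exact: lt_le_trans tT.
have itv c : t0 < c < t -> t0 < c < T.
  by move=> /andP[-> ct]; rewrite (lt_le_trans ct tT).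
have itvW c : t0 < c < t -> t0 <= c <= T.
  by move=> /itv/andP[/ltW-> /ltW->].
have Mh0 : 0 <= Mh.
  by apply: le_trans (fhM t 0 m _ Pm); rewrite ?enorm_ge0// tT ltW.
have Mn0 : 0 <= Mn.
  by apply: le_trans (fnM t 0 m _ Pm); rewrite ?enorm_ge0// tT ltW.
apply: (@enorm_growth R N (fun s => uh s m - Psi (un s m)) t0 t K
  (Mh + 1 + k * (Mn + 1)) E) => //.
- by rewrite !addr_ge0// mulr_ge0// addr_ge0.
- apply: (@continuous_subspaceW _ _ _ `[t0, T]).
    by apply: subset_itvl; rewrite bnd_simp.
  move=> x; apply: cvgB; first exact: (C1_state_continuous_time Ch Pm).
  apply: cvg_comp; first exact: (C1_state_continuous_time Cn Pm).
  exact: (lipschitz_continuous Psik).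
- move=> c ct; near=> s.
  have duh : `|uh s m - uh c m| <= (Mh + 1) * (s - c).
    near: s; apply: (right_deriv_le (right_deriv_solution sh Pm (itv _ ct))).
    rewrite (le_lt_trans (mxnorm_enorm _))//.
    by rewrite (le_lt_trans (fhM c (uh c m) m (itvW _ ct) Pm))// ltrDl.
  have dun : `|un s m - un c m| <= (Mn + 1) * (s - c).
    near: s; apply: (right_deriv_le (right_deriv_solution sn Pm (itv _ ct))).
    rewrite (le_lt_trans (mxnorm_enorm _))//.
    by rewrite (le_lt_trans (fnM c (un c m) m (itvW _ ct) Pm))// ltrDl.
  have -> : uh s m - Psi (un s m) - (uh c m - Psi (un c m)) =
      uh s m - uh c m - (Psi (un s m) - Psi (un c m)).
    by rewrite !opprD !opprK addrACA.
  rewrite (le_trans (ler_normB _ _))// mulrDl lerD//.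
  by rewrite (le_trans (Psik _ _))// -mulrA ler_wpM2l.
- move=> c ct nEc; have [dPsi fK] := good c (itvW _ ct) nEc.
  exists (fh c (uh c m) m - fn c (un c m) m *m 'J Psi (un c m)) => //.
  rewrite /jacobian mul_rV_lin1.
  apply: right_derivB; first exact: right_deriv_solution sh Pm (itv _ ct).
  apply: (right_deriv_comp (u := un ^~ m) (f := Psi)) => //.
  exact: right_deriv_solution sn Pm (itv _ ct).
Unshelve. all: by end_near. Qed.

Unset Implicit Arguments.

Theorem proposition3p3 (R : realType) (p N n : nat) (t0 T : R)
  (P : set 'rV[R]_p)
  (fh : R -> 'rV[R]_N -> 'rV[R]_p -> 'rV[R]_N)
  (u0h : 'rV[R]_p -> 'rV[R]_N)
  (uh : R -> 'rV[R]_p -> 'rV[R]_N)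
  (Psi : 'rV[R]_N -> 'rV[R]_n)
  (Psi' : 'rV[R]_n -> 'rV[R]_N)
  (fn : R -> 'rV[R]_n -> 'rV[R]_p -> 'rV[R]_n)
  (un : R -> 'rV[R]_p -> 'rV[R]_n) :
  (n < N)%N ->
  t0 < T ->
  compact P ->
  full_support P ->
  wellposed_field t0 T P fh ->
  wellposed_field t0 T P fn ->
  C1_state t0 T P uh ->
  solves_ivp t0 T P fh u0h uh ->
  latent_dynamics_model t0 T P u0h uh Psi Psi' fn un ->
  (* the Jacobian of Psi' along un exists almost everywhere *)
  {ae time_param_measure p, forall x, time_param t0 T P x ->
    differentiable Psi' (un x.1 x.2)} ->
  forall (mu : 'rV[R]_p) (t : R), P mu -> t0 <= t <= T ->
  ((enorm (uh t mu - Psi' (un t mu)))%:E <=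
     Linfty_norm (lebesgue_rV p) P (fun m => (u0h m - Psi' (Psi (u0h m)))%R) +
     `|T - t0|%:E *
       Linfty_norm (time_param_measure p) (time_param t0 T P)
         (fun x => (fh x.1 (uh x.1 x.2) x.2 -
                    fn x.1 (un x.1 x.2) x.2 *m 'J Psi' (un x.1 x.2))%R))%E.
Proof.
move=> _ t0T cP fP wfh wfn Ch sh [_ [lPsi' Cn sn] _] dPsi mu t Pmu tI.
set K0 := Linfty_norm (lebesgue_rV p) _ _.
set K1 := Linfty_norm (time_param_measure p) _ _.
have K0_ge0 : (0 <= K0)%E by exact: Linfty_norm_ge0.
have K1_ge0 : (0 <= K1)%E by exact: Linfty_norm_ge0.
have Tt0 : 0 < `|T - t0| by rewrite normr_gt0 subr_eq0 gt_eqF.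
(* An infinite norm makes the right-hand side infinite, because neither term
   is [-oo] and [T - t0] is not 0. *)
have [K0y|K0y] := eqVneq K0 +oo%E.
  by rewrite K0y addye ?leey// gt_eqF// (lt_le_trans ltNy0)// mule_ge0.
have [K1y|K1y] := eqVneq K1 +oo%E.
  by rewrite K1y gt0_muley ?lte_fin// addey ?leey// gt_eqF// (lt_le_trans ltNy0).
have K0fin : K0 \is a fin_num by rewrite ge0_fin_numE// lt_neqAle K0y leey.
have K1fin : K1 \is a fin_num by rewrite ge0_fin_numE// lt_neqAle K1y leey.
rewrite -(fineK K0fin) -(fineK K1fin) -EFinM -EFinD lee_fin.
pose g s m := uh s m - Psi' (un s m).
pose B := fine K0 + `|T - t0| * fine K1.
have good : {ae lebesgue_rV p, forall m, P m ->
    forall s, t0 <= s <= T -> enorm (g s m) <= B}.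
  have K1ae : {ae time_param_measure p, forall x, time_param t0 T P x ->
      differentiable Psi' (un x.1 x.2) /\
      enorm (fh x.1 (uh x.1 x.2) x.2 -
        fn x.1 (un x.1 x.2) x.2 *m 'J Psi' (un x.1 x.2)) <= fine K1}.
    apply: filterS2 dPsi (ae_le_Linfty_norm _ _ _) => x dx leK1 Dx.
    by split; [exact: dx|rewrite -lee_fin fineK//; exact: leK1].
  have K0ae : {ae lebesgue_rV p, forall m, P m ->
      enorm (u0h m - Psi' (Psi (u0h m))) <= fine K0}.
    apply: filterS (ae_le_Linfty_norm _ _ _) => x leK0 Px.
    by rewrite -lee_fin fineK//; exact: leK0.
  have secae : {ae lebesgue_rV p, forall m,
      (@lebesgue_measure R).-negligible (ysection (~` [set x |
        time_param t0 T P x -> differentiable Psi' (un x.1 x.2) /\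
        enorm (fh x.1 (uh x.1 x.2) x.2 -
        fn x.1 (un x.1 x.2) x.2 *m 'J Psi' (un x.1 x.2)) <= fine K1]) m)}.
    exact: negligible_ysection K1ae.
  apply: filterS2 K0ae secae => m m0 mE Pm s sI.
  have [uh0 _] := sh m Pm; have [un0 _] := sn m Pm.
  have := @error_growth R p N n t0 T (fine K1) P fh u0h uh Psi' fn _ un m _
    (fine_ge0 K1_ge0) wfh wfn Ch Cn sh sn lPsi' Pm mE _ s sI.
  rewrite -/(g s m) uh0 un0 /= => gs; apply: (le_trans (gs _)).
    move=> r rI nE; apply: contrapT => bad; apply: nE.
    by rewrite /ysection/= inE => /(_ (conj rI Pm)).
  apply: lerD; first exact: m0.
  rewrite mulrC ler_wpM2r ?fine_ge0// gtr0_norm ?subr_gt0// lerD2r.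
  by case/andP: sI.
(* If the bound failed at [mu], it would fail on a relative neighbourhood of
   [mu] in [P], which contains a parameter where it holds. *)
rewrite -/(g t mu) leNgt; apply/negP => bad.
have gc : enorm (g t m) @[m --> within P (nbhs mu)] --> enorm (g t mu).
  apply: cvg_comp; last exact: enorm_continuous.
  apply: cvgB; first exact: (C1_state_cvg_param Ch tI Pmu).
  apply: cvg_comp; first exact: (C1_state_cvg_param Cn tI Pmu).
  by have [k [_ /lipschitz_continuous]] := lipschitzP lPsi'; exact.
have gB : nbhs mu [set m | P m -> B < enorm (g t m)].
  exact: (gc _ (lt_nbhsr bad)).
have [m [Pm Om /(_ t tI)]] := full_support_dense cP fP good
  (@open_interior _ [set m | P m -> B < enorm (g t m)])
  (ex_intro _ mu (conj Pmu gB)).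
by rewrite leNgt (interior_subset Om Pm).
Qed.
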